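(* Let $\tilde{x}_\theta(\mathbf{u}) \in \mathcal{X}$ be an approximation to $x_\theta(\mathbf{u})$ such that $$\|x_\theta(\mathbf{u}) - \tilde{x}_\theta(\mathbf{u})\|_{\mathcal{X}} \le \varepsilon_\theta \|x_\theta(\mathbf{u})\|_{\mathcal{X}}, \qquad 0\le \varepsilon_\theta\le\varepsilon<1,$$ holds for all $\theta\in\mathcal{P}$ and $\mathbf{u}\in\mathbb{R}^M$. Then $$\tilde\beta_G(\theta) - \gamma_L\,\overline{\eta}(\theta)\,\varepsilon_\theta \;\le\; \beta_G(\theta) \;\le\; \tilde\beta_G(\theta) + \gamma_L\,\overline{\eta}(\theta)\,\varepsilon_\theta.$$
   Context: Setting. $\mathcal{X}$ is a real Hilbert space with inner product $\langle\cdot,\cdot\rangle_{\mathcal{X}}$, norm $\|\cdot\|_{\mathcal{X}}$ and dual $\mathcal{X}'$; $\mathcal{P} \subset \mathbb{R}^p$ is a compact set of hyper-parameters (configurations). For each $\theta\in\mathcal{P}$ and each parameter $\mathbf{u}\in\mathbb{R}^M$ there is a (full-order) state $x_\theta(\mathbf{u})\in\mathcal{X}$; the map $\mathbf{u}\mapsto x_\theta(\mathbf{u})$ is linear. $\Sigma_{\mathrm{pr}}\in\mathbb{R}^{M\times M}$ is a symmetric positive definite (prior covariance) matrix, and $\|\mathbf{u}\|_{\Sigma_{\mathrm{pr}}^{-1}}^2 := \mathbf{u}^T\Sigma_{\mathrm{pr}}^{-1}\mathbf{u}$. The states are uniformly bounded: there is $\bar\eta>0$ with $\overline{\eta}(\theta)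 := \sup_{\mathbf{u}\neq 0} \|x_\theta(\mathbf{u})\|_{\mathcal{X}} / \|\mathbf{u}\|_{\Sigma_{\mathrm{pr}}^{-1}} < \bar\eta$ for all $\theta\in\mathcal{P}$. The surrogate $\mathbf{u}\mapsto\tilde x_\theta(\mathbf{u})\in\mathcal{X}$ is not assumed to have further structure. Observation operator. $L = [\ell_1,\dots,\ell_K]^T : \mathcal{X}\to\mathbb{R}^K$, $Lx = [\ell_1(x),\dots,\ell_K(x)]^T$, with continuous linear functionals $\ell_k\in\mathcal{X}'$. $\Sigma_L\in\mathbb{R}^{K\times K}$ is symmetric positive definite (noise covariance), and $\|\mathbf{d}\|_{\Sigma_L^{-1}}^2 := \mathbf{d}^T\Sigma_L^{-1}\mathbf{d}$. Coefficients (all infima and suprema of quotients are over nonzero elements): $$\gamma_L := \sup_{x\in\mathcal{X}} \frac{\|Lx\|_{\Sigma_L^{-1}}}{\|x\|_{\mathcal{X}}},\quad \beta_G(\theta) := \inf_{\mathbf{u}\in\mathbb{R}^M}\frac{\|Lx_\theta(\mathbf{u})\|_{\Sigma_L^{-1}}}{\|\mathbf{u}\|_{\Sigma_{\mathrm{pr}}^{-1}}},\quad \tilde\beta_G(\theta) := \inf_{\mathbf{u}\in\mathbb{R}^M}\frac{\|L\tilde x_\theta(\mathbf{u})\|_{\Sigma_L^{-1}}}{\|\mathbf{u}\|_{\Sigma_{\mathrm{pr}}^{-1}}}.$$ *)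

(* Defs.v *)
From mathcomp Require Export all_boot all_order all_algebra.
From mathcomp Require Export all_classical all_reals all_analysis.
Export Order.TTheory GRing.Theory Num.Theory numFieldNormedType.Exports.

Set Implicit Arguments.
Unset Strict Implicit.
Unset Printing Implicit Defensive.

Local Open Scope classical_set_scope.
Local Open Scope ring_scope.

Definition spd (R : realType) (n : nat) (A : 'M[R]_n) : Prop :=
  A^T = A /\ forall v : 'cV[R]_n, v != 0 -> 0 < (v^T *m A *m v) 0 0.

(* The norm weighted by the inverse of S: the argument is the covariance S
   itself, not its inverse. *)
Definition invnorm (R : realType) (n : nat) (S : 'M[R]_n) (v : 'cV[R]_n) : R :=
  Num.sqrt ((v^T *m invmx S *m v) 0 0).

(* The complete normed space X is a Hilbert space with inner product ip when
   its norm is the one induced by the symmetric positive definite form ip. *)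
Definition norm_induced_by (R : realType) (X : completeNormedModType R)
    (ip : {dot X for idfun}) : Prop :=
  forall x : X, `|x| = Num.sqrt (ip x x).

Definition obs (R : realType) (X : completeNormedModType R) (K : nat)
    (l : 'I_K -> {scalar X}) (x : X) : 'cV[R]_K :=
  \col_k l k x.

(* The coefficients below are real-valued [sup]/[inf], which are 0 on the empty
   set and where [sup] is also 0 on a set without upper bound.  All quotients
   are nonnegative, so the sets are bounded below; the set of [gamma] is bounded
   above as soon as the functionals are continuous, and boundedness of
   [state_gains] has to be required explicitly where finiteness of [eta] is
   meant. *)

Definition gamma (R : realType) (X : completeNormedModType R) (K : nat)
    (SL : 'M[R]_K) (l : 'I_K -> {scalar X}) : R :=
  sup [set invnorm SL (obs l x) / `|x| | x in [set x : X | x != 0]].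

Definition state_gains (R : realType) (X : completeNormedModType R) (M : nat)
    (Spr : 'M[R]_M) (y : 'cV[R]_M -> X) : set R :=
  [set `|y u| / invnorm Spr u | u in [set u : 'cV[R]_M | u != 0]].

Definition eta (R : realType) (X : completeNormedModType R) (M : nat)
    (Spr : 'M[R]_M) (y : 'cV[R]_M -> X) : R :=
  sup (state_gains Spr y).

Definition beta (R : realType) (X : completeNormedModType R) (K M : nat)
    (SL : 'M[R]_K) (l : 'I_K -> {scalar X})
    (Spr : 'M[R]_M) (y : 'cV[R]_M -> X) : R :=
  inf [set invnorm SL (obs l (y u)) / invnorm Spr u
      | u in [set u : 'cV[R]_M | u != 0]].

(* Main.v *)
Require Import Defs.
From mathcomp Require Import ring lra.

Set Implicit Arguments.
Unset Strict Implicit.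
Unset Printing Implicit Defensive.

(** The bound is the stability of an infimum under uniform perturbation.  For
    [u != 0], linearity of the observation operator [L] and the reverse
    triangle inequality for the weighted norm give
      [| ||L x(u)|| - ||L x'(u)|| | <= ||L (x(u) - x'(u))||
          <= gamma |x(u) - x'(u)| <= gamma eps |x(u)| <= gamma eps eta ||u||],
    so that after division by [||u||] the two families of quotients whose infima
    are [beta] for [x] and [beta] for [x'] differ by at most [gamma eta eps]
    at each [u], and hence so do their infima ([inf_image_le_add]).

    Two facts support this chain.  The inverse of a symmetric positive definite
    matrix is symmetric positive definite ([spd_invmx]), which makes [invnorm] a
    norm: the triangle inequality is Minkowski's inequality for a positive
    definite quadratic form ([qform_triangle]).  And [gamma], a real-valued
    supremum, is an honest operator bound ([invnorm_obs_le]) only because the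
    quotients defining it are bounded; this is where continuity of the
    functionals enters ([gamma_has_ubound]). *)

Local Open Scope classical_set_scope.
Local Open Scope ring_scope.

(** * Norms weighted by an inverse covariance *)

Section WeightedNorm.
Variables (R : realType) (n : nat).
Implicit Types (A S : 'M[R]_n) (u v w : 'cV[R]_n).

Definition bform A v w : R := (v^T *m A *m w) 0 0.

Lemma bformDl A u v w : bform A (u + v) w = bform A u w + bform A v w.
Proof. by rewrite /bform linearD /= !mulmxDl mxE. Qed.

Lemma bformDr A u v w : bform A u (v + w) = bform A u v + bform A u w.
Proof. by rewrite /bform mulmxDr mxE. Qed.

Lemma bformZl A a v w : bform A (a *: v) w = a * bform A v w.
Proof. by rewrite /bform linearZ /= -!scalemxAl mxE. Qed.

Lemma bformZr A a v w : bform A v (a *: w) = a * bform A v w.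
Proof. by rewrite /bform -scalemxAr mxE. Qed.

Lemma bformC A v w : A^T = A -> bform A v w = bform A w v.
Proof.
move=> AT; rewrite /bform.
have -> : w^T *m A *m v = (v^T *m A *m w)^T.
  by rewrite !trmx_mul trmxK AT mulmxA.
by rewrite [RHS]mxE.
Qed.

Lemma bform_ge0 A v : spd A -> 0 <= bform A v v.
Proof.
move=> [_ Apos]; have [->|/Apos/ltW //] := eqVneq v 0.
by rewrite /bform mulmx0 mxE.
Qed.

(** A singular [S] would have a nonzero kernel vector [v], and then
    [v^T S v = 0]. *)
Lemma spd_unitmx S : spd S -> S \in unitmx.
Proof.
move=> [_ Spos]; rewrite -row_free_unit -kermx_eq0.
apply/eqP/row_matrixP => i; rewrite row0; apply/eqP/negPn/negP => v_neq0.
have := Spos (row i (kermx S))^T; rewrite trmx_eq0 trmxK => /(_ v_neq0).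
by rewrite (sub_kermxP (row_sub i _)) mul0mx mxE ltxx.
Qed.

(** Substituting [v = S w] turns [v^T S^-1 v] into [w^T S w]. *)
Lemma spd_invmx S : spd S -> spd (invmx S).
Proof.
move=> Sspd; have Su := spd_unitmx Sspd; have [ST Spos] := Sspd.
have SVT : (invmx S)^T = invmx S by rewrite trmx_inv ST.
split=> // v v_neq0.
have w_neq0 : invmx S *m v != 0.
  by apply: contraNneq v_neq0 => w0; rewrite -(mulKVmx Su v) w0 mulmx0.
by have := Spos _ w_neq0; rewrite trmx_mul SVT -!mulmxA mulKVmx // !mulmxA.
Qed.

(** Expanding [0 <= q (b v - a w)] for [a = sqrt (q v)] and [b = sqrt (q w)]
    gives the Cauchy-Schwarz inequality [bform A v w <= a b], and from it
    [q (v + w) <= (a + b) ^ 2]. *)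
Lemma qform_triangle A v w : spd A ->
  Num.sqrt (bform A (v + w) (v + w))
    <= Num.sqrt (bform A v v) + Num.sqrt (bform A w w).
Proof.
move=> Aspd; have [AT Apos] := Aspd.
have [->|v_neq0] := eqVneq v 0; first by rewrite add0r lerDr sqrtr_ge0.
have [->|w_neq0] := eqVneq w 0; first by rewrite addr0 lerDl sqrtr_ge0.
set a := Num.sqrt (bform A v v); set b := Num.sqrt (bform A w w).
have a_gt0 : 0 < a by rewrite sqrtr_gt0 Apos.
have b_gt0 : 0 < b by rewrite sqrtr_gt0 Apos.
have a2 : bform A v v = a ^+ 2 by rewrite sqr_sqrtr ?bform_ge0.
have b2 : bform A w w = b ^+ 2 by rewrite sqr_sqrtr ?bform_ge0.
have wv : bform A w v = bform A v w by exact: bformC.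
have cauchy : bform A v w <= a * b.
  have ab_gt0 : 0 < a * b by exact: mulr_gt0.
  have := bform_ge0 (b *: v + (- a) *: w) Aspd.
  rewrite !bformDl !bformDr !bformZl !bformZr a2 b2 wv => expanded.
  by rewrite -(ler_pM2l ab_gt0); nra.
have ab_ge0 : 0 <= a + b by rewrite addr_ge0 // ltW.
rewrite -[leRHS]ger0_norm // -sqrtr_sqr ler_sqrt ?sqr_ge0 //.
by rewrite !bformDl !bformDr a2 b2 wv; nra.
Qed.

Lemma invnorm_ge0 S v : 0 <= invnorm S v.
Proof. exact: sqrtr_ge0. Qed.

Lemma invnorm0 S : invnorm S 0 = 0.
Proof. by rewrite /invnorm mulmx0 mxE sqrtr0. Qed.

Lemma invnorm_gt0 S v : spd S -> v != 0 -> 0 < invnorm S v.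
Proof. by move=> /spd_invmx[_ Vpos] /Vpos; rewrite sqrtr_gt0. Qed.

Lemma invnormZ S a v : invnorm S (a *: v) = `|a| * invnorm S v.
Proof.
rewrite /invnorm -!/(bform _ _ _) bformZl bformZr mulrA -expr2.
by rewrite sqrtrM ?sqr_ge0 // sqrtr_sqr.
Qed.

Lemma invnormD S v w : spd S -> invnorm S (v + w) <= invnorm S v + invnorm S w.
Proof. by move=> /spd_invmx; exact: qform_triangle. Qed.

Lemma invnorm_sum S (I : Type) (r : seq I) (F : I -> 'cV[R]_n) : spd S ->
  invnorm S (\sum_(i <- r) F i) <= \sum_(i <- r) invnorm S (F i).
Proof.
move=> Sspd; elim/big_ind2: _ => [|a v b w va wb|//]; first by rewrite invnorm0.
by apply: le_trans (invnormD v w Sspd) _; exact: lerD.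
Qed.

End WeightedNorm.

(** * The observation operator *)

(** Where [E] is empty or unbounded, [sup E] takes its default value [0]. *)
Lemma sup_ge0 (R : realType) (E : set R) :
  (forall r, E r -> 0 <= r) -> 0 <= sup E.
Proof.
move=> E_ge0; have [[[r Er] E_bounded]|no_sup] := pselect (has_sup E).
  by apply: le_trans (E_ge0 r Er) _; exact: (ub_le_sup E_bounded).
by rewrite sup_out.
Qed.

Section Observation.
Variables (R : realType) (X : completeNormedModType R) (K : nat).
Variables (SL : 'M[R]_K) (l : 'I_K -> {scalar X}).

Lemma obsB x y : obs l (x - y) = obs l x - obs l y.
Proof. by apply/colP => k; rewrite !mxE linearB. Qed.

Lemma obs_delta x : obs l x = \sum_k l k x *: delta_mx k 0.
Proof.
rewrite [LHS]matrix_sum_delta; apply: eq_bigr => k _.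
by rewrite big_ord1 mxE.
Qed.

Hypothesis SL_spd : spd SL.
Hypothesis l_cont : forall k, continuous (l k : X -> R).

Lemma scalar_bounded k : exists C, forall x, `|l k x| <= C * `|x|.
Proof.
have /linear_boundedP /pinfty_ex_gt0 [C _ HC] :
  bounded_near (l k : X -> R^o) (nbhs 0).
  by apply: continuous_linear_bounded; exact: l_cont.
by exists C.
Qed.

(** Decomposing [obs l x] along the standard basis, the triangle inequality
    bounds the quotients by [\sum_k C k * invnorm SL (delta_mx k 0)], with [C k]
    a bound of the functional [l k]. *)
Lemma gamma_has_ubound :
  has_ubound [set invnorm SL (obs l x) / `|x| | x in [set x : X | x != 0]].
Proof.
have [C HC] := choice scalar_bounded.
exists (\sum_k C k * invnorm SL (delta_mx k 0)) => _ /= [x x_neq0 <-].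
rewrite ler_pdivrMr ?normr_gt0 // obs_delta.
apply: le_trans (invnorm_sum _ _ SL_spd) _.
rewrite mulr_suml; apply: ler_sum => k _.
by rewrite invnormZ mulrAC ler_wpM2r ?invnorm_ge0.
Qed.

Lemma gamma_ge0 : 0 <= gamma SL l.
Proof.
by apply: sup_ge0 => _ [x _ <-]; rewrite divr_ge0 ?invnorm_ge0.
Qed.

Lemma invnorm_obs_le x : invnorm SL (obs l x) <= gamma SL l * `|x|.
Proof.
have [->|x_neq0] := eqVneq x 0.
  have -> : obs l 0 = 0 by rewrite -(subrr 0) obsB subrr.
  by rewrite invnorm0 normr0 mulr0.
rewrite -ler_pdivrMr ?normr_gt0 //.
by apply: (ub_le_sup gamma_has_ubound); exists x.
Qed.

Lemma invnorm_obs_perturb x y :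
  invnorm SL (obs l x) <= invnorm SL (obs l y) + gamma SL l * `|x - y|.
Proof.
rewrite -[in leLHS](subrK y x) -[_ - y + y]addrC.
have -> : obs l (y + (x - y)) = obs l y + obs l (x - y).
  by rewrite obsB addrC subrK addrC subrK.
apply: le_trans (invnormD _ _ SL_spd) _.
by rewrite lerD2l invnorm_obs_le.
Qed.

End Observation.

(** * Perturbation of the observability coefficient *)

(** The nonnegativity of [c] covers an empty [D], where both infima are [0]. *)
Lemma inf_image_le_add (R : realType) (T : Type) (D : set T) (f g : T -> R)
    (c : R) : 0 <= c -> (forall t, D t -> 0 <= f t) ->
  (forall t, D t -> f t <= g t + c) ->
  inf [set f t | t in D] <= inf [set g t | t in D] + c.
Proof.
move=> c_ge0 f_ge0 fg; have [->|D_neq0] := eqVneq D set0.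
  by rewrite !image_set0 inf0 add0r.
have [t0 Dt0] : D !=set0 by exact/set0P.
rewrite -lerBlDr; apply: lb_le_inf => [|_ [t Dt <-]].
  by exists (g t0), t0.
rewrite lerBlDr; apply: le_trans (fg t Dt).
by apply: ge_inf; [exists 0 => _ [s Ds <-]; exact: f_ge0 | exists t].
Qed.

Lemma state_le_eta (R : realType) (X : completeNormedModType R) (M : nat)
    (Spr : 'M[R]_M) (y : 'cV[R]_M -> X) (u : 'cV[R]_M) :
  spd Spr -> has_ubound (state_gains Spr y) -> u != 0 ->
  `|y u| <= eta Spr y * invnorm Spr u.
Proof.
move=> Spr_spd y_bounded u_neq0.
rewrite -ler_pdivrMr ?invnorm_gt0 //.
by apply: (ub_le_sup y_bounded); exists u.
Qed.

(** The closeness of [y] and [z] is symmetric, so this one-sided estimate, applied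
    again with [y] and [z] exchanged, yields both sides of a two-sided bound. *)
Lemma beta_perturb (R : realType) (X : completeNormedModType R) (K M : nat)
    (SL : 'M[R]_K) (l : 'I_K -> {scalar X}) (Spr : 'M[R]_M)
    (y z : 'cV[R]_M -> X) (d : R) :
  spd SL -> (forall k, continuous (l k : X -> R)) -> spd Spr -> 0 <= d ->
  (forall u, u != 0 -> `|y u - z u| <= d * invnorm Spr u) ->
  beta SL l Spr y <= beta SL l Spr z + gamma SL l * d.
Proof.
move=> SL_spd l_cont Spr_spd d_ge0 yz.
apply: inf_image_le_add => [|u u_neq0|u u_neq0].
- by rewrite mulr_ge0 ?gamma_ge0.
- by rewrite divr_ge0 ?invnorm_ge0.
have u_gt0 := invnorm_gt0 Spr_spd u_neq0.
rewrite ler_pdivrMr // mulrDl divfK ?gt_eqF //.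
apply: le_trans (invnorm_obs_perturb SL_spd l_cont (y u) (z u)) _.
by rewrite lerD2l -mulrA ler_wpM2l ?gamma_ge0 ?yz.
Qed.

Theorem proposition2 (R : realType)
    (X : completeNormedModType R) (ip : {dot X for idfun})
    (X_hilbert : norm_induced_by ip)
    (p : nat) (P : set 'cV[R]_p) (P_compact : compact P)
    (M : nat) (Spr : 'M[R]_M) (Spr_spd : spd Spr)
    (K : nat) (SL : 'M[R]_K) (SL_spd : spd SL)
    (l : 'I_K -> {scalar X})
    (l_cont : forall k : 'I_K, continuous (l k : X -> R))
    (x : 'cV[R]_p -> 'cV[R]_M -> X)
    (x_linear : forall theta, P theta -> linear (x theta))
    (eta_bar : R) (eta_bar_gt0 : 0 < eta_bar)
    (x_bounded : forall theta, P theta ->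
       has_ubound (state_gains Spr (x theta)) /\
       eta Spr (x theta) < eta_bar)
    (x' : 'cV[R]_p -> 'cV[R]_M -> X)
    (eps : 'cV[R]_p -> R) (eps_max : R) (eps_max_lt1 : eps_max < 1)
    (eps_bound : forall theta, P theta -> 0 <= eps theta <= eps_max)
    (x'_approx : forall theta (u : 'cV[R]_M), P theta ->
       `|x theta u - x' theta u| <= eps theta * `|x theta u|) :
  forall theta, P theta ->
    beta SL l Spr (x' theta)
        - gamma SL l * eta Spr (x theta) * eps theta
      <= beta SL l Spr (x theta)
    /\ beta SL l Spr (x theta)
      <= beta SL l Spr (x' theta)
        + gamma SL l * eta Spr (x theta) * eps theta.
Proof.
move=> theta Ptheta.
have [bounded_gains _] := x_bounded theta Ptheta.
have /andP[eps_ge0 _] := eps_bound theta Ptheta.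
have eta_ge0 : 0 <= eta Spr (x theta).
  by apply: sup_ge0 => _ [u _ <-]; rewrite divr_ge0 ?invnorm_ge0.
have d_ge0 : 0 <= eta Spr (x theta) * eps theta by exact: mulr_ge0.
have close u : u != 0 ->
  `|x theta u - x' theta u| <= eta Spr (x theta) * eps theta * invnorm Spr u.
  move=> u_neq0; apply: le_trans (x'_approx theta u Ptheta) _.
  by rewrite [eta _ _ * _]mulrC -mulrA ler_wpM2l // state_le_eta.
rewrite lerBlDr -mulrA; split; apply: beta_perturb => // u u_neq0.
by rewrite distrC close.
Qed.
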